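(* If $X$ is a star-$K$-Scheepers space and $Y$ is a $\sigma$-compact space, then $X\times Y$ is star-$K$-Scheepers.
   Context: For a subset $A$ of a space $Z$ and a collection $\mathcal{P}$ of subsets of $Z$, $St(A,\mathcal{P})=\bigcup\{B\in\mathcal{P}: A\cap B\neq\emptyset\}$. An open cover $\mathcal{U}$ of $Z$ is an $\omega$-cover if each finite $F\subseteq Z$ is contained in some $U\in\mathcal{U}$ (the set $Z$ itself is allowed to be a member). $Z$ is star-$K$-Scheepers if for each sequence $(\mathcal{U}_n)_{n\in\mathbb{N}}$ of open covers of $Z$ there is a sequence $(K_n)_{n\in\mathbb{N}}$ of compact subsets of $Z$ such that $\{St(K_n,\mathcal{U}_n): n\in\mathbb{N}\}$ is an $\omega$-cover of $Z$. *)

(* Defs.v *)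
From mathcomp Require Import all_boot all_order.
From mathcomp Require Import all_classical topology.

Set Implicit Arguments.
Unset Strict Implicit.
Unset Printing Implicit Defensive.

Local Open Scope classical_set_scope.

Definition star (Z : Type) (A : set Z) (P : set (set Z)) : set Z :=
  \bigcup_(B in [set B | P B /\ A `&` B !=set0]) B.

Definition open_cover (Z : topologicalType) (U : set (set Z)) : Prop :=
  U `<=` open /\ cover U id = setT.

(* [setT] is allowed to be a member of an omega-cover. *)
Definition omega_cover (Z : topologicalType) (U : set (set Z)) : Prop :=
  open_cover U /\
  forall F : set Z, finite_set F -> exists2 V, U V & F `<=` V.

Definition star_K_Scheepers (Z : topologicalType) : Prop :=
  forall U : nat -> set (set Z), (forall n, open_cover (U n)) ->
  exists2 K : nat -> set Z, (forall n, compact (K n)) &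
    omega_cover (range (fun n => star (K n) (U n))).

(* No separation axiom: [compact] does not include Hausdorff. *)
Definition sigma_compact (Z : topologicalType) : Prop :=
  exists2 K : nat -> set Z, (forall n, compact (K n)) & \bigcup_n K n = setT.

(* Main.v *)
(** Write Y as a union of compact sets D_m such that every finite subset of Y
    lies in some D_m. By the tube lemma, an open cover U of X * Y induces for
    each m the open cover of X by those V such that every slice V * {y} with y
    in D_m lies in a member of U; if K meets V at k, then (k, y) witnesses that
    V * {y} is contained in the star of K * D_m. Splitting the indices into
    infinitely many sequences, one for each m, and applying the hypothesis on X
    to each of them gives the required compact sets K * D_m. *)

Require Import Defs.
From mathcomp Require Import all_boot all_order.
From mathcomp Require Import all_classical topology.

Local Open Scope classical_set_scope.

Lemma open_star {Z : topologicalType} (A : set Z) (P : set (set Z)) :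
  P `<=` open -> open (star A P).
Proof. by move=> Pop; apply: bigcup_open => B [/Pop]. Qed.

(** Singletons are finite, so the condition on finite sets already makes the stars cover [Z]. *)
Lemma omega_cover_range_star {Z : topologicalType} (I : Type)
    (A : I -> set Z) (U : I -> set (set Z)) :
  (forall i, U i `<=` open) ->
  (forall F, finite_set F -> exists i, F `<=` star (A i) (U i)) ->
  omega_cover (range (fun i => star (A i) (U i))).
Proof.
move=> Uop Astar; split; last first.
  by move=> F /Astar[i FA]; exists (star (A i) (U i)) => //; exists i.
split; first by move=> _ [i _ <-]; exact: open_star.
rewrite -subTset => z _; have [i zA] := Astar _ (finite_set1 z).
by exists (star (A i) (U i)); [exists i | exact: zA].
Qed.

Lemma sigma_compact_finite_subset {Y : topologicalType} : sigma_compact Y ->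
  exists2 D : nat -> set Y, (forall m, compact (D m)) &
    forall F, finite_set F -> exists m, F `<=` D m.
Proof.
move=> [C Ccpt CT]; have /choice[m Cm] (y : Y) : exists m, C m y.
  by have : setT y by []; rewrite -CT => -[m _]; exists m.
exists (fun n => \big[setU/set0]_(i < n) C i).
  by move=> n; exact: bigsetU_compact.
(* The successor is needed because the [n]-th partial union stops before [C n]. *)
move=> F /finite_seqP[s ->]; exists (\max_(y <- s) (m y).+1)%N.
by rewrite -bigcup_mkord => y ys; exists (m y) => //=; exact: leq_bigmax_seq.
Qed.

Definition slice_cover {X Y : Type} (C : set Y) (U : set (set (X * Y))) :
    set (set X) :=
  [set V | forall y, C y -> exists2 B, U B & V `*` [set y] `<=` B].

Lemma open_cover_slice {X Y : topologicalType} {C : set Y}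
    {U : set (set (X * Y))} :
  compact C -> open_cover U -> open_cover (open `&` slice_cover C U).
Proof.
move=> /compact_near_coveringP Ccpt [Uop UT]; split=> [V []//|].
rewrite -subTset => x _.
pose P (V : set X) y := exists2 B, U B & V `*` [set y] `<=` B.
have Pmono V W y : V `<=` W -> P W y -> P V y.
  by move=> VW [B UB WB]; exists B => // -[a b] [/= /VW Wa yb]; exact: WB.
(* Tube lemma through near-covering compactness: along the filter of small neighbourhoods [V] of
   [x], it suffices to treat points near each [y] in [C]. *)
have : \forall V \near powerset_filter_from (nbhs x), C `<=` P V.
  apply: Ccpt => y _.
  have : setT (x, y) by []; rewrite -UT => -[B UB Bxy].
  have [[O W] /= [xO yW] OWB] : nbhs (x, y) B.
    by apply: open_nbhs_nbhs; split => //; exact: Uop.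
  exists (W, [set V | V `<=` O]) => /=; last first.
    move=> [y' V] [/= Wy' VO]; exists B => // -[a b] [/= /VO Oa ->].
    exact: OWB.
  by split=> //; exact: small_set_sub.
move=> /near_powerset_filter_fromP[V W VW CW y /CW|V xV CV].
  exact: Pmono.
(* [V] is only a neighbourhood of [x]; its interior is open and inherits [P]. *)
exists V^°; last exact: xV.
split; first exact: open_interior.
by move=> y /CV; apply: Pmono; exact: interior_subset.
Qed.

Lemma star_slice_subset {X Y : Type} (K : set X) (C : set Y)
    (U : set (set (X * Y))) :
  star K (slice_cover C U) `*` C `<=` star (K `*` C) U.
Proof.
move=> [x y] [/= [V [CV [k [Kk Vk]]] Vx] Cy].
have [B UB VB] := CV _ Cy; exists B; last exact: VB.
by split => //; exists (k, y); split => //; exact: VB.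
Qed.

Theorem corollary4p13 (X Y : topologicalType) :
  star_K_Scheepers X -> sigma_compact Y ->
  star_K_Scheepers (X * Y)%type.
Proof.
move=> SX /sigma_compact_finite_subset[D Dcpt Dfin] U Ucov.
pose W m (k : nat) := open `&` slice_cover (D m) (U (pickle (m, k))).
have /choice[K KP] m : exists K : nat -> set X, (forall k, compact (K k)) /\
    omega_cover (range (fun k => star (K k) (W m k))).
  have [|K Kcpt Kcov] := SX (W m); last by exists K.
  by move=> k; exact: open_cover_slice.
(* Any compact set would do at an index that codes no pair: only the stars at codes [pickle (m, k)]
   are used to capture finite sets. *)
pose L n := if unpickle n is Some (m, k) then K m k `*` D m else set0.
exists L.
  move=> n; rewrite /L; case: unpickle => [[m k]|]; last exact: compact0.
  by apply: compact_setX => //; have [] := KP m.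
apply: omega_cover_range_star => [n|F Ffin]; first by have [] := Ucov n.
have [m FD] := Dfin _ (finite_image snd Ffin).
(* The second projection of [F] has fixed [m]; the first now selects [k] within the [m]-th
   subsequence. *)
have [_ [_ /(_ _ (finite_image fst Ffin))[_ [k _ <-] FK]]] := KP m.
exists (pickle (m, k)); rewrite /L pickleK => z Fz.
apply: star_slice_subset; split; last by apply: FD; exists z.
have [V [[_ WV] KV] Vz] : star (K m k) (W m k) z.1 by apply: FK; exists z.
by exists V.
Qed.
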